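(* Let $n\ge2$ and let $H\in C^1(\mathbb{R}^n\setminus\{0\})$ be a positive homogeneous function of degree $1$ with $H(\xi)>0$ for any $\xi\in\mathbb{R}^n\setminus\{0\}$. Assume that its unit ball $B_1^H=\{\xi\in\mathbb{R}^n:H(\xi)<1\}$ is strictly convex. Then the condition $$\langle H(\xi)\nabla H(\xi),H^*(x)\nabla H^*(x)\rangle=\langle\xi,x\rangle\quad\text{for any }\xi,x\in\mathbb{R}^n$$ holds if and only if there is a symmetric and positive definite real $n\times n$ matrix $M$ such that $$H(\xi)=\sqrt{\langle M\xi,\xi\rangle}\quad\text{for any }\xi\in\mathbb{R}^n.$$
   Context: Positive homogeneous of degree $1$ means $H(t\xi)=tH(\xi)$ for $t>0$ and $\xi\ne0$ ($H$ is not assumed even); $H(0):=0$. The dual function is $H^*(x):=\sup_{\xi\in S^{n-1}}\frac{\langle x,\xi\rangle}{H(\xi)}$ (which is $C^1$ away from the origin when $B_1^H$ is strictly convex). The fields $H\nabla H$ and $H^*\nabla H^*$ are extended (continuously) by $0$ at the origin. *)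

(* Defs.v *)
From mathcomp Require Import all_boot all_order all_algebra.
From mathcomp Require Import all_classical all_reals all_analysis.

Set Implicit Arguments.
Unset Strict Implicit.
Unset Printing Implicit Defensive.

Import Order.TTheory GRing.Theory Num.Theory.
Import numFieldNormedType.Exports.

Local Open Scope classical_set_scope.
Local Open Scope ring_scope.

(* R^n is 'rV[R]_n. Its library norm is the sup norm, which gives the usual
   topology and differential; Euclidean quantities are defined from inner. *)

Definition inner (R : realType) (n : nat) (x y : 'rV[R]_n) : R :=
  \sum_(i < n) x 0 i * y 0 i.

Definition enorm (R : realType) (n : nat) (x : 'rV[R]_n) : R :=
  Num.sqrt (inner x x).

Definition esphere (R : realType) (n : nat) : set 'rV[R]_n :=
  [set x | enorm x = 1].

Definition grad (R : realType) (n : nat) (f : 'rV[R]_n -> R) (x : 'rV[R]_n)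
    : 'rV[R]_n :=
  \row_(i < n) 'D_(delta_mx 0 i) f x.

(* Meant for an open set A, on which continuity at each point in the ambient
   topology is the same as continuity of the restriction. *)
Definition C1_on (R : realType) (n : nat) (A : set 'rV[R]_n)
    (f : 'rV[R]_n -> R) : Prop :=
  forall x, A x -> differentiable f x /\ {for x, continuous (grad f)}.

Definition pos_homogeneous1 (R : realType) (n : nat) (f : 'rV[R]_n -> R)
    : Prop :=
  forall (t : R) (x : 'rV[R]_n), 0 < t -> x != 0 -> f (t *: x) = t * f x.

Definition unit_ball (R : realType) (n : nat) (H : 'rV[R]_n -> R)
    : set 'rV[R]_n :=
  [set x | H x < 1].

Definition strictly_convex (R : realType) (n : nat) (A : set 'rV[R]_n)
    : Prop :=
  forall x y : 'rV[R]_n, closure A x -> closure A y -> x != y ->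
  forall t : R, 0 < t < 1 -> interior A (t *: x + (1 - t) *: y).

Definition dual_fun (R : realType) (n : nat) (H : 'rV[R]_n -> R) (x : 'rV[R]_n)
    : R :=
  sup [set inner x xi / H xi | xi in @esphere R n].

(* The field f * grad f, extended by 0 at the origin, where f need not be
   differentiable. *)
Definition scaled_grad (R : realType) (n : nat) (f : 'rV[R]_n -> R)
    (x : 'rV[R]_n) : 'rV[R]_n :=
  if x == 0 then 0 else f x *: grad f x.

(* The matrix-vector product M x, for x a row vector. *)
Definition mxapp (R : realType) (n : nat) (M : 'M[R]_n) (x : 'rV[R]_n)
    : 'rV[R]_n :=
  x *m M^T.

Definition sym_posdef (R : realType) (n : nat) (M : 'M[R]_n) : Prop :=
  M^T = M /\ forall x : 'rV[R]_n, x != 0 -> 0 < inner (mxapp M x) x.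

(* Main.v *)
Require Import Defs.
From mathcomp Require Import all_boot all_order all_algebra.
From mathcomp Require Import all_classical all_reals all_analysis.
From mathcomp Require Import ring lra.

Import Order.TTheory GRing.Theory Num.Theory.
Import numFieldNormedType.Exports.

Local Open Scope classical_set_scope.
Local Open Scope ring_scope.

(** If the identity holds, put x = e_j in it: the j-th coordinate of xi is
    the pairing of H grad H (xi) with the fixed vector H* grad H* (e_j).  So
    the field H grad H, followed by one fixed linear map B, is the identity of
    R^n.  Then B is invertible and H grad H is itself linear.  Euler's relation
    <grad H (xi), xi> = H(xi) turns this into H(xi)^2 = <A xi, xi>, and M is the
    symmetric part of A ([scaled_grad_linear], [inner_scaled_grad]).

    Conversely, for H = sqrt <M xi, xi> the Cauchy-Schwarz inequality of the
    scalar product <M ., .> shows that H* is the norm sqrt <M^-1 x, x>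
    ([dual_fun_quad_norm]).  The half gradient of the square of such a norm is
    the matrix itself ([scaled_grad_quad_norm]), so the two fields are M and
    M^-1, and these cancel because M is symmetric. *)

(** * The Euclidean pairing and quadratic forms *)

Section Inner.
Context {R : realType} {n : nat}.
Implicit Types (x y z : 'rV[R]_n) (A : 'M[R]_n).

Lemma innerE x y : inner x y = (x *m y^T) 0 0.
Proof. by rewrite mxE; apply: eq_bigr => i _; rewrite mxE. Qed.

Lemma innerC x y : inner x y = inner y x.
Proof. by apply: eq_bigr => i _; rewrite mulrC. Qed.

Lemma innerDl x y z : inner (x + y) z = inner x z + inner y z.
Proof. by rewrite !innerE mulmxDl mxE. Qed.

Lemma innerDr x y z : inner z (x + y) = inner z x + inner z y.
Proof. by rewrite innerC innerDl !(innerC z). Qed.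

Lemma innerZl a x y : inner (a *: x) y = a * inner x y.
Proof. by rewrite !innerE -scalemxAl mxE. Qed.

Lemma innerZr a x y : inner x (a *: y) = a * inner x y.
Proof. by rewrite innerC innerZl innerC. Qed.

Lemma inner0l x : inner 0 x = 0.
Proof. by rewrite innerE mul0mx mxE. Qed.

Lemma inner_delta x j : inner x (delta_mx 0 j) = x 0 j.
Proof.
rewrite /inner (bigD1 j) //= mxE !eqxx mulr1 big1 ?addr0 // => i /negPf ij.
by rewrite mxE ij andbF mulr0.
Qed.

Lemma enormZ a x : 0 <= a -> enorm (a *: x) = a * enorm x.
Proof.
move=> a_ge0; rewrite /enorm innerZl innerZr mulrA -expr2.
by rewrite sqrtrM ?sqr_ge0 // sqrtr_sqr ger0_norm.
Qed.

Lemma enorm_gt0 x : x != 0 -> 0 < enorm x.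
Proof.
move=> x_neq0; have sq_ge0 i : true -> 0 <= x 0 i * x 0 i.
  by rewrite -expr2 sqr_ge0.
rewrite sqrtr_gt0 lt0r sumr_ge0 // andbT; apply: contra x_neq0.
rewrite psumr_eq0 // => /allP sq0; apply/eqP/rowP => i.
have := sq0 i (mem_index_enum i).
by rewrite mulf_eq0 orbb mxE => /eqP.
Qed.

Lemma esphere_neq0 x : @esphere R n x -> x != 0.
Proof.
move=> x1; apply/eqP => x0; move: x1; rewrite x0 /esphere /= /enorm inner0l.
by rewrite sqrtr0 => /esym/eqP; rewrite oner_eq0.
Qed.

Lemma esphere_normalize x : x != 0 -> @esphere R n ((enorm x)^-1 *: x).
Proof.
move=> /enorm_gt0 nx_gt0; rewrite /esphere /= enormZ ?invr_ge0 ?ltW //.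
by rewrite mulVf ?gt_eqF.
Qed.

Lemma inner_mxapp A x y : inner (mxapp A x) y = inner x (mxapp A^T y).
Proof. by rewrite !innerE /mxapp trmxK trmx_mul mulmxA. Qed.

Lemma mxappD A x y : mxapp A (x + y) = mxapp A x + mxapp A y.
Proof. exact: mulmxDl. Qed.

Lemma mxappZ A a x : mxapp A (a *: x) = a *: mxapp A x.
Proof. by rewrite /mxapp -scalemxAl. Qed.

Lemma mxapp0 A : mxapp A 0 = 0 :> 'rV_n.
Proof. exact: mul0mx. Qed.

Definition quad A x : R := inner (mxapp A x) x.

Definition quad_norm A x : R := Num.sqrt (quad A x).

Lemma quadZ A a x : quad A (a *: x) = a ^+ 2 * quad A x.
Proof. by rewrite /quad mxappZ innerZl innerZr mulrA. Qed.

Lemma quad_line A x v h : A^T = A ->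
  quad A (h *: v + x) =
  quad A x + (2 * inner (mxapp A x) v) * h + quad A v * h ^+ 2.
Proof.
move=> A_sym; rewrite /quad mxappD mxappZ !innerDl !innerDr !innerZl !innerZr.
rewrite [inner (mxapp A v) x]inner_mxapp A_sym [inner v _]innerC.
by ring.
Qed.

Section PosDef.
Context {A : 'M[R]_n} (A_pd : sym_posdef A).

Lemma quad_gt0 x : x != 0 -> 0 < quad A x.
Proof. by case: A_pd => _; apply. Qed.

Lemma quad_ge0 x : 0 <= quad A x.
Proof.
have [->|/quad_gt0/ltW //] := eqVneq x 0.
by rewrite /quad mxapp0 inner0l.
Qed.

Lemma cauchy_schwarz_quad x y :
  inner (mxapp A x) y <= quad_norm A x * quad_norm A y.
Proof.
have [->|y_neq0] := eqVneq y 0.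
  by rewrite innerC inner0l mulr_ge0 ?sqrtr_ge0.
have qy_gt0 := quad_gt0 y y_neq0.
rewrite -sqrtrM ?quad_ge0 //.
apply: le_trans (ler_norm _) _; rewrite -sqrtr_sqr ler_wsqrtr //.
(* this t minimises the quadratic form on the line x + t y *)
set b := inner _ y; pose t := - b / quad A y.
have := quad_ge0 (t *: y + x); rewrite quad_line; last by case: A_pd.
rewrite -/b /t.
have -> : quad A x + 2 * b * (- b / quad A y) + quad A y * (- b / quad A y) ^+ 2
  = (quad A x * quad A y - b ^+ 2) / quad A y.
  by field; rewrite gt_eqF.
by rewrite pmulr_lge0 ?invr_gt0 // subr_ge0.
Qed.

(** A kernel vector would annihilate the quadratic form. *)
Lemma sym_posdef_unit : A \in unitmx.
Proof.
rewrite -row_free_unit; apply: inj_row_free => v vA0.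
apply/eqP; apply: contraT => /quad_gt0.
by case: A_pd => A_sym _; rewrite /quad /mxapp A_sym vA0 inner0l ltxx.
Qed.

Lemma mxappVK x : mxapp A (mxapp (invmx A) x) = x.
Proof.
by rewrite /mxapp -mulmxA -trmx_mul mulmxV ?sym_posdef_unit // trmx1 mulmx1.
Qed.

Lemma invmx_sym : (invmx A)^T = invmx A.
Proof. by case: A_pd => A_sym _; rewrite trmx_inv A_sym. Qed.

Lemma quad_invmx x : quad (invmx A) x = quad A (mxapp (invmx A) x).
Proof. by rewrite /quad mxappVK innerC. Qed.

Lemma sym_posdef_invmx : sym_posdef (invmx A).
Proof.
split=> [|x x_neq0]; first exact: invmx_sym.
rewrite -/(quad _ x) quad_invmx quad_gt0 //.
by apply: contra x_neq0 => /eqP x0; rewrite -[x]mxappVK x0 mxapp0.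
Qed.

End PosDef.
End Inner.

(** * Gradients *)

Section Gradients.
Context {R : realType} {n : nat}.
Implicit Types (x v : 'rV[R]_n) (f : 'rV[R]_n -> R).

(** Reduces directional derivatives to one variable, where the chain rule and
    the derivative of the square root are at hand. *)
Lemma derive_line f x v : 'D_v f x = 'D_1 (fun h : R => f (h *: v + x)) 0.
Proof.
rewrite /derive; congr (lim (_ @ 0^')); apply/funext => h /=.
by rewrite scale0r add0r addr0 [h *: 1]mulr1.
Qed.

(** Expand v in the standard basis and use linearity of the differential. *)
Lemma inner_grad f x v : differentiable f x -> inner (grad f x) v = 'D_v f x.
Proof.
move=> df; rewrite deriveE // [v in RHS]row_sum_delta linear_sum.
by apply: eq_bigr => i _; rewrite mxE linearZ /= deriveE // mulrC.
Qed.

(** Along the ray through x the difference quotients of f are eventually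
    constant, equal to f x. *)
Lemma derive_pos_homogeneous1 f x :
  pos_homogeneous1 f -> x != 0 -> 'D_x f x = f x.
Proof.
move=> f_hom x_neq0; apply: cvg_lim => //; apply: cvg_near_cst.
near=> h => /=.
have h_neq0 : h != 0 by near: h; exact: nbhs_dnbhs_neq.
have h1_gt0 : 0 < h + 1.
  rewrite -ltrBlDr sub0r; near: h; apply: nbhs_dnbhs.
  by apply: lt_nbhsr; rewrite ltrN10.
have -> : h *: x + x = (h + 1) *: x by rewrite scalerDl scale1r.
rewrite f_hom // -[X in _ - X]mul1r -mulrBl addrK.
by rewrite [_ *: _]mulrA mulVf // mul1r.
Unshelve. all: by end_near. Qed.

Lemma inner_scaled_grad f x : f 0 = 0 -> pos_homogeneous1 f ->
    (x != 0 -> differentiable f x) ->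
  inner (scaled_grad f x) x = f x ^+ 2.
Proof.
rewrite /scaled_grad => f0 f_hom df; case: eqVneq => [->|x_neq0].
  by rewrite inner0l f0 expr0n.
by rewrite innerZl inner_grad ?derive_pos_homogeneous1 //; exact: df.
Qed.

Lemma derive_quad_norm {A : 'M[R]_n} x v : sym_posdef A -> x != 0 ->
  'D_v (quad_norm A) x = inner (mxapp A x) v / quad_norm A x.
Proof.
move=> A_pd x_neq0; have qx_gt0 := quad_gt0 A_pd x x_neq0.
pose p (h : R) := quad A x + (2 * inner (mxapp A x) v) * h + quad A v * h ^+ 2.
rewrite derive_line.
have -> : (fun h : R => quad_norm A (h *: v + x)) = Num.sqrt \o p.
  by apply/funext => h; rewrite /quad_norm quad_line //; case: A_pd.
have p0 : p 0 = quad A x by rewrite /p mulr0 expr0n mulr0 !addr0.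
have dp : is_derive (0 : R) (1 : R) p (2 * inner (mxapp A x) v).
  have -> : p = horner ((quad A x)%:P + (2 * inner (mxapp A x) v) *: 'X
                        + quad A v *: 'X^2).
    by apply/funext => h; rewrite /p !hornerE.
  apply: is_derive_eq.
  rewrite !derivD derivC !derivZ derivX derivXn !hornerE /=; ring.
have dsqrt : is_derive (p 0) (1 : R) Num.sqrt (2 * Num.sqrt (p 0))^-1.
  by apply: is_derive1_sqrt; rewrite p0.
have [_ ->] := is_derive1_comp dsqrt dp.
rewrite p0 /quad_norm; field.
by rewrite gt_eqF // sqrtr_gt0.
Qed.

Lemma scaled_grad_quad_norm (A : 'M[R]_n) x : sym_posdef A ->
  scaled_grad (quad_norm A) x = mxapp A x.
Proof.
move=> A_pd; rewrite /scaled_grad; case: eqVneq => [->|x_neq0].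
  by rewrite mxapp0.
apply/rowP => i; rewrite !mxE derive_quad_norm // inner_delta mxE.
by rewrite mulrC divfK // gt_eqF // sqrtr_gt0 quad_gt0.
Qed.

End Gradients.

(** * The dual of a quadratic norm *)

(** With z = A^-1 x the quotients are <A z, y> / |y|_A, which Cauchy-Schwarz
    bounds by |z|_A = sqrt <A^-1 x, x>, with equality at y = z / |z|. *)
Lemma dual_fun_quad_norm (R : realType) (n : nat) (A : 'M[R]_n) :
  (0 < n)%N -> sym_posdef A -> dual_fun (quad_norm A) = quad_norm (invmx A).
Proof.
move=> n_gt0 A_pd; apply/funext => x.
set z := mxapp (invmx A) x.
have xE : x = mxapp A z by rewrite mxappVK.
have -> : quad_norm (invmx A) x = quad_norm A z.
  by rewrite /quad_norm quad_invmx.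
rewrite /dual_fun; set E := [set _ | _ in _].
have E_ub : ubound E (quad_norm A z).
  move=> _ [y /esphere_neq0 y_neq0 <-].
  rewrite ler_pdivrMr ?sqrtr_gt0 ?quad_gt0 // xE.
  exact: cauchy_schwarz_quad.
suff Ez : E (quad_norm A z).
  apply/eqP; rewrite eq_le; apply/andP; split.
    by apply: ge_sup => //; exists (quad_norm A z).
  by apply: ub_le_sup => //; exists (quad_norm A z).
have [z0|z_neq0] := eqVneq z 0.
  (* then x = 0 and every quotient is 0; any point of the sphere will do *)
  have e_neq0 : delta_mx 0 (Ordinal n_gt0) != 0 :> 'rV[R]_n.
    apply/eqP => /rowP/(_ (Ordinal n_gt0))/eqP.
    by rewrite !mxE !eqxx oner_eq0.
  exists ((enorm (delta_mx 0 (Ordinal n_gt0)))^-1 *: delta_mx 0 (Ordinal n_gt0)).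
    exact: esphere_normalize.
  by rewrite xE z0 mxapp0 inner0l mul0r /quad_norm /quad mxapp0 inner0l sqrtr0.
have nz_gt0 := enorm_gt0 z z_neq0.
exists ((enorm z)^-1 *: z); first exact: esphere_normalize.
have qz_gt0 := quad_gt0 A_pd z z_neq0.
rewrite /quad_norm quadZ sqrtrM ?sqr_ge0 // sqrtr_sqr ger0_norm; last first.
  by rewrite invr_ge0 ltW.
rewrite innerZr xE -/(quad A z) -mulf_div divff ?invr_neq0 ?gt_eqF // mul1r.
rewrite -[X in X / _](sqr_sqrtr (ltW qz_gt0)) expr2 mulfK //.
by rewrite gt_eqF // sqrtr_gt0.
Qed.

(** * The identity forces linearity *)

(** Pairing with the G(e_j) reads off coordinates, so F followed by the matrix
    with columns G(e_j) is the identity.  On the basis this says that a product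
    of two square matrices is 1, which makes that matrix invertible. *)
Lemma scaled_grad_linear (R : realType) (n : nat)
    (F G : 'rV[R]_n -> 'rV[R]_n) :
  (forall xi x, inner (F xi) (G x) = inner xi x) ->
  exists A : 'M[R]_n, forall xi, F xi = mxapp A xi.
Proof.
move=> FG; pose B : 'M[R]_n := \matrix_(i, j) G (delta_mx 0 j) 0 i.
have FB xi : F xi *m B = xi.
  apply/rowP => j; rewrite -[RHS]inner_delta -FG mxE.
  by apply: eq_bigr => i _; rewrite mxE.
pose C : 'M[R]_n := \matrix_i F (delta_mx 0 i).
have CB : C *m B = 1%:M.
  by apply/row_matrixP => i; rewrite row_mul rowK FB row1.
have [_ B_unit] := mulmx1_unit CB.
exists (invmx B)^T => xi.
by rewrite /mxapp trmxK -[in RHS](FB xi) mulmxK.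
Qed.

(** The identity determines H through the quadratic form of A alone, so A may be
    replaced by its symmetric part. *)
Definition sym_part {R : realType} {n : nat} (A : 'M[R]_n) : 'M[R]_n :=
  2^-1 *: (A + A^T).

Lemma tr_sym_part (R : realType) (n : nat) (A : 'M[R]_n) :
  (sym_part A)^T = sym_part A.
Proof. by rewrite /sym_part linearZ /= linearD /= trmxK addrC. Qed.

Lemma quad_sym_part (R : realType) (n : nat) (A : 'M[R]_n) x :
  quad (sym_part A) x = quad A x.
Proof.
rewrite /quad {1}/mxapp tr_sym_part -scalemxAr mulmxDr innerZl innerDl.
have -> : inner (x *m A) x = inner (mxapp A x) x.
  by rewrite inner_mxapp innerC /mxapp trmxK.
by rewrite -/(mxapp A x); field.
Qed.

Theorem theorem1p2 (R : realType) (n : nat) (n_ge2 : (2 <= n)%N)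
    (H : 'rV[R]_n -> R)
    (H0 : H 0 = 0)
    (H_C1 : C1_on [set~ 0] H)
    (H_hom : pos_homogeneous1 H)
    (H_pos : forall xi : 'rV[R]_n, xi != 0 -> 0 < H xi)
    (H_sconv : strictly_convex (unit_ball H)) :
  (forall xi x : 'rV[R]_n,
     inner (scaled_grad H xi) (scaled_grad (dual_fun H) x) = inner xi x)
  <->
  (exists M : 'M[R]_n,
     sym_posdef M /\
     forall xi : 'rV[R]_n, H xi = Num.sqrt (inner (mxapp M xi) xi)).
Proof.
split=> [/scaled_grad_linear[A HA]|[M [M_pd HM]] xi x].
  have H2 xi : quad (sym_part A) xi = H xi ^+ 2.
    rewrite quad_sym_part /quad -HA inner_scaled_grad // => /eqP xi_neq0.
    by have [] := H_C1 xi xi_neq0.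
  exists (sym_part A); split.
    split=> [|xi /H_pos Hxi]; first exact: tr_sym_part.
    by rewrite -/(quad _ xi) H2 exprn_gt0.
  move=> xi; rewrite -/(quad _ xi) H2 sqrtr_sqr ger0_norm //.
  by have [->|/H_pos/ltW //] := eqVneq xi 0; rewrite H0.
have -> : H = quad_norm M by apply/funext => y; rewrite HM.
rewrite dual_fun_quad_norm ?(ltnW n_ge2) //.
rewrite !scaled_grad_quad_norm ?inner_mxapp //; last exact: sym_posdef_invmx.
by have [-> _] := M_pd; rewrite mxappVK.
Qed.
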